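(* Every non-nilpotent full interacting Fock space is non-regular. That is: let $(H_n)_{n\in\mathbb N_0}$ be pre-Hilbert spaces with $H_0=\Omega\mathbb C$ for a unit vector $\Omega$ and $H_n\neq\{0\}$ for all $n$, put $\mathcal I=\bigoplus_{n\in\mathbb N_0}H_n$ and let $A^*:=\mathscr L_{(1)}(\mathcal I)$. Then there is no pre-Hilbert space $H$ with a surjective linear map $a^*\colon H\to A^*$ such that the associated map $\Lambda\colon\mathscr F(H)\to\mathcal I$ has an adjoint in $\mathscr L(\mathcal I,\overline{\mathscr F(H)})$.
   Context: All vector spaces are complex; direct sums and tensor products of pre-Hilbert spaces are algebraic; $\overline V$ is the completion of a pre-Hilbert space $V$; $\mathscr L(V,W)$ is the space of all linear maps $V\to W$, $\mathscr L(V)=\mathscr L(V,V)$. For $\mathcal I=\bigoplus_{n\in\mathbb N_0}H_n$, $\mathscr L_{(1)}(\mathcal I)$ is the set of all $a\in\mathscr L(\mathcal I)$ of degree $1$, i.e. $aH_m\subset H_{m+1}$ for all $m\in\mathbb N_0$. An interacting Fock space is a pair consisting of such $\mathcal I$ (with $H_0=\Omega\mathbb C$, $\Omega$ a unit vector) and a linear subspace $A^*\subset\mathscr L(\mathcal I)$ with $\operatorname{span}A^*H_n=H_{n+1}$ for all $n$. It is full if $A^*=\mathscr L_{(1)}(\mathcal I)$, and non-nilpotent if $H_n\ne\{0\}$ for all $n$. For a pre-Hilbert space $H$, $\mathscr F(H)=\Omega\mathbb C\oplus\bigoplus_{n\ge1}H^{\otimes n}$ is the algebraic full Fock space with its natural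 inner product. Given a surjective linear map $a^*\colon H\to A^*$ (a basing of $\mathcal I$ on $H$), $\Lambda\colon\mathscr F(H)\to\mathcal I$ is the linear map with $\Lambda\Omega=\Omega$ and $\Lambda(x_n\otimes\dots\otimes x_1)=a^*(x_n)\cdots a^*(x_1)\Omega$. The basing is regular if there is $\Lambda^*\in\mathscr L(\mathcal I,\overline{\mathscr F(H)})$ with $\langle\Lambda X,Y\rangle=\langle X,\Lambda^*Y\rangle$ for all $X\in\mathscr F(H)$, $Y\in\mathcal I$. An interacting Fock space is regular if it admits a regular basing on some pre-Hilbert space, and non-regular otherwise. *)

(* Defs.v *)
From HB Require Import structures.
From mathcomp Require Import all_boot all_order all_algebra.
From mathcomp Require Import complex generic_quotient.
From mathcomp Require Import boolp classical_sets functions reals topology.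
From mathcomp Require Import normedtype sequences interval_inference.

Set Implicit Arguments.
Unset Strict Implicit.
Unset Printing Implicit Defensive.

Import Order.TTheory GRing.Theory Num.Theory.
Import numFieldNormedType.Exports.

Local Open Scope classical_set_scope.
Local Open Scope ring_scope.

HB.mixin Record isPreHilbert (C : numClosedFieldType) U of GRing.Lmodule C U := {
  ip : U -> U -> C;
  ip_linearl : forall z : U, scalar (ip^~ z);
  ip_conj : forall x y : U, ip x y = (ip y x)^*;
  ip_gt0 : forall x : U, x != 0 -> 0 < ip x x
}.

#[short(type="preHilbertType")]
HB.structure Definition PreHilbert (C : numClosedFieldType) :=
  {U of GRing.Lmodule C U & isPreHilbert C U}.

Notation "''[' x , y ]" := (ip x y) : ring_scope.

Section IpTheory.
Variables (C : numClosedFieldType) (U : preHilbertType C).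
Implicit Types (x y z : U) (a : C).

Fact ip_bilinear : bilinear_for (GRing.Scale.Law.clone _ _ *%R _)
  (GRing.Scale.Law.clone _ _ (Num.conj \; *%R) _) (@ip C U).
Proof.
split=> [z a x y|x a y z] /=; first exact: ip_linearl.
by rewrite ip_conj ip_linearl rmorphD rmorphM /= -!ip_conj.
Qed.

HB.instance Definition _ := bilinear_isBilinear.Build C U U C _ _ (@ip C U) ip_bilinear.
Fact ip_hermitian x y : '[x, y] = (-1) ^+ false * Num.conj '[y, x].
Proof. by rewrite mul1r ip_conj. Qed.
HB.instance Definition _ :=
  isHermitianSesquilinear.Build C U false Num.conj (@ip C U) ip_hermitian.
HB.instance Definition _ := isDotProduct.Build C U (@ip C U) (@ip_gt0 C U).

Lemma ipC x y : '[x, y] = Num.conj '[y, x]. Proof. exact: ip_conj. Qed.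
Lemma ip0l y : '[0, y] = 0. Proof. exact: linear0l. Qed.
Lemma ip0r x : '[x, 0] = 0. Proof. exact: linear0r. Qed.
Lemma ipDl x y z : '[x + y, z] = '[x, z] + '[y, z]. Proof. exact: linearDl. Qed.
Lemma ipDr z x y : '[z, x + y] = '[z, x] + '[z, y]. Proof. exact: linearDr. Qed.
Lemma ipBl x y z : '[x - y, z] = '[x, z] - '[y, z]. Proof. exact: linearBl. Qed.
Lemma ipBr z x y : '[z, x - y] = '[z, x] - '[z, y]. Proof. exact: linearBr. Qed.
Lemma ipZl a x y : '[a *: x, y] = a * '[x, y]. Proof. exact: linearZl_LR. Qed.
Lemma ipZr a x y : '[x, a *: y] = Num.conj a * '[x, y]. Proof. exact: linearZr_LR. Qed.
Lemma ip_suml I (r : seq I) (P : pred I) (F : I -> U) y :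
  '[\sum_(i <- r | P i) F i, y] = \sum_(i <- r | P i) '[F i, y].
Proof. exact: linear_sumlz. Qed.
Lemma ip_sumr I (r : seq I) (P : pred I) (F : I -> U) y :
  '[y, \sum_(i <- r | P i) F i] = \sum_(i <- r | P i) '[y, F i].
Proof. exact: linear_sumr. Qed.
Lemma ip_ge0 x : 0 <= '[x, x]. Proof. exact: dnorm_ge0. Qed.
Lemma ip_eq0 x : ('[x, x] == 0) = (x == 0). Proof. exact: dnorm_eq0. Qed.

Definition nrm x := sqrtC '[x, x].

Lemma nrm_ge0 x : 0 <= nrm x. Proof. by rewrite sqrtC_ge0 ip_ge0. Qed.
Lemma nrm_sq x : nrm x ^+ 2 = '[x, x]. Proof. exact: sqrtCK. Qed.
Lemma nrm_eq0 x : (nrm x == 0) = (x == 0). Proof. by rewrite sqrtC_eq0 ip_eq0. Qed.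
Lemma nrm0 : nrm 0 = 0. Proof. by apply/eqP; rewrite nrm_eq0. Qed.
Lemma nrmZ a x : nrm (a *: x) = `|a| * nrm x.
Proof.
rewrite /nrm ipZl ipZr mulrA -normCK sqrtCM ?qualifE/= ?ip_ge0 ?exprn_ge0//.
by rewrite sqrCK.
Qed.
Lemma nrmN x : nrm (- x) = nrm x.
Proof. by rewrite -scaleN1r nrmZ normrN1 mul1r. Qed.
Lemma nrm_distC x y : nrm (x - y) = nrm (y - x).
Proof. by rewrite -nrmN opprB. Qed.

Lemma cauchy_schwarz x y : `|'[x, y]| <= nrm x * nrm y.
Proof.
have [->|y0] := eqVneq y 0; first by rewrite ip0r normr0 nrm0 mulr0.
have yy0 : '[y, y] != 0 by rewrite ip_eq0.
rewrite -(@ler_pXn2r _ 2) ?qualifE/= ?mulr_ge0 ?nrm_ge0// exprMn !nrm_sq.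
pose a := '[x, y] / '[y, y]; pose u := x - a *: y.
have uy : '[u, y] = 0 by rewrite ipBl ipZl divfK// subrr.
have -> : '[x, y] = a * '[y, y] by rewrite divfK.
have -> : '[x, x] = '[u, u] + `|a| ^+ 2 * '[y, y].
  have -> : x = u + a *: y by rewrite subrK.
  clearbody u a.
  have yu : '[y, u] = 0 by rewrite ipC uy rmorph0.
  by rewrite ipDl !ipDr !ipZl !ipZr uy yu !mulr0 addr0 add0r mulrA normCK.
rewrite normrM (ger0_norm (ip_ge0 y)) exprMn mulrDl -[X in _ + X]mulrA -[in leRHS]expr2.
by rewrite lerDr mulr_ge0 ?ip_ge0.
Qed.

Lemma ler_nrmD x y : nrm (x + y) <= nrm x + nrm y.
Proof.
rewrite -(@ler_pXn2r _ 2) ?qualifE/= ?addr_ge0 ?nrm_ge0// nrm_sq sqrrD !nrm_sq.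
rewrite ipDl !ipDr (ipC y x).
have -> : '[x, x] + '[x, y] + (Num.conj '[x, y] + '[y, y]) =
  '[x, x] + ('[x, y] + Num.conj '[x, y]) + '[y, y] by rewrite !addrA.
rewrite lerD2r lerD2l.
have re : '[x, y] + Num.conj '[x, y] \is Num.real.
  by rewrite CrealE rmorphD /= conjCK addrC.
apply: le_trans (real_ler_norm re) _.
apply: le_trans (ler_normD _ _) _.
by rewrite norm_conjC mulr2n lerD// cauchy_schwarz.
Qed.

Lemma ler_dist_nrmD z x y : nrm (x - y) <= nrm (x - z) + nrm (z - y).
Proof. by apply: le_trans (ler_nrmD _ _); rewrite addrA subrK. Qed.

Lemma orthonormal_expansion (s : seq U) : exists2 e : seq U,
  (forall i j : 'I_(size e), '[e`_i, e`_j] = (i == j)%:R) &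
  forall x, x \in s -> x = \sum_(i < size e) '[x, e`_i] *: e`_i.
Proof.
elim: s => [|x s [e eo es]].
  by exists [::] => // -[].
pose p := \sum_(i < size e) '[x, e`_i] *: e`_i.
have po (j : 'I_(size e)) : '[p, e`_j] = '[x, e`_j].
  rewrite ip_suml (bigD1 j)//= ipZl eo eqxx mulr1 big1 ?addr0// => i ij.
  by rewrite ipZl eo (negPf ij) mulr0.
have [xp|xp] := eqVneq x p.
  by exists e => // y; rewrite inE => /predU1P[->//|/es].
pose r := x - p; have r0 : r != 0 by rewrite subr_eq0.
have re (j : 'I_(size e)) : '[r, e`_j] = 0 by rewrite ipBl po subrr.
have xE : x = r + p by rewrite subrK.
clearbody r.
pose u := (nrm r)^-1 *: r.
have nr0 : nrm r != 0 by rewrite nrm_eq0.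
have rnr : Num.conj (nrm r)^-1 = (nrm r)^-1.
  by apply: geC0_conj; rewrite invr_ge0 nrm_ge0.
have uu : '[u, u] = 1.
  by rewrite ipZl ipZr rnr -nrm_sq expr2 mulKf// mulVf.
have ue (j : 'I_(size e)) : '[u, e`_j] = 0 by rewrite ipZl re mulr0.
have eu (j : 'I_(size e)) : '[e`_j, u] = 0 by rewrite ipC ue rmorph0.
exists (u :: e).
  move=> /= i j.
  case: (unliftP ord0 i) => [i'|] ->; case: (unliftP ord0 j) => [j'|] -> /=.
  - by rewrite eo (inj_eq lift_inj).
  - by rewrite eu.
  - by rewrite ue.
  - by rewrite uu.
move=> y; rewrite inE big_ord_recl /= => /predU1P[->|ys].
  rewrite -/p; have -> : '[x, u] = nrm r.
    rewrite xE.
    have -> : '[r + p, u] = '[r, u].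
      rewrite ipDl /p ip_suml big1 ?addr0// => i _.
      by rewrite ipZl eu mulr0.
    by rewrite ipZr rnr -nrm_sq expr2 mulKf.
  by rewrite scalerA mulfV// scale1r -xE.
have -> : '[y, u] = 0.
  by rewrite (es _ ys) ip_suml big1// => i _; rewrite ipZl eu mulr0.
rewrite scale0r add0r {1}(es _ ys).
by [].
Qed.

End IpTheory.

Section DirectSum.
Variables (C : numClosedFieldType) (H : nat -> preHilbertType C).

Record dsum := DSum {
  dval :> forall n, H n;
  dval_fin : exists N, forall n, (N <= n)%N -> dval n = 0
}.
Implicit Types f g h : dsum.

HB.instance Definition _ := gen_eqMixin dsum.
HB.instance Definition _ := gen_choiceMixin dsum.

Lemma dsumP f g : (forall n, f n = g n) -> f = g.
Proof.
case: f g => [f fP] [g gP] /= fg.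
have {fg}E : f = g by exact: functional_extensionality_dep.
by case: _ / E gP => gP; congr DSum; exact: Prop_irrelevance.
Qed.

Fact dsum0_fin : exists N, forall n, (N <= n)%N -> (0 : H n) = 0.
Proof. by exists 0. Qed.
Definition dsum0 := DSum dsum0_fin.

Fact dsum_opp_fin f : exists N, forall n, (N <= n)%N -> - f n = 0.
Proof. by have [N fN] := dval_fin f; exists N => n /fN->; rewrite oppr0. Qed.
Definition dsum_opp f := DSum (dsum_opp_fin f).

Fact dsum_add_fin f g : exists N, forall n, (N <= n)%N -> f n + g n = 0.
Proof.
have [[M fM] [N gN]] := (dval_fin f, dval_fin g).
by exists (maxn M N) => n; rewrite geq_max => /andP[/fM-> /gN->]; rewrite addr0.
Qed.
Definition dsum_add f g := DSum (dsum_add_fin f g).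

Fact dsum_scale_fin (a : C) f : exists N, forall n, (N <= n)%N -> a *: f n = 0.
Proof. by have [N fN] := dval_fin f; exists N => n /fN->; rewrite scaler0. Qed.
Definition dsum_scale a f := DSum (dsum_scale_fin a f).

Fact dsum_addA : associative dsum_add.
Proof. by move=> f g h; apply: dsumP => n /=; rewrite addrA. Qed.
Fact dsum_addC : commutative dsum_add.
Proof. by move=> f g; apply: dsumP => n /=; rewrite addrC. Qed.
Fact dsum_add0 : left_id dsum0 dsum_add.
Proof. by move=> f; apply: dsumP => n /=; rewrite add0r. Qed.
Fact dsum_addN : left_inverse dsum0 dsum_opp dsum_add.
Proof. by move=> f; apply: dsumP => n /=; rewrite addNr. Qed.
HB.instance Definition _ :=
  GRing.isZmodule.Build dsum dsum_addA dsum_addC dsum_add0 dsum_addN.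

Fact dsum_scaleA a b f : dsum_scale a (dsum_scale b f) = dsum_scale (a * b) f.
Proof. by apply: dsumP => n /=; rewrite scalerA. Qed.
Fact dsum_scale1 : left_id 1 dsum_scale.
Proof. by move=> f; apply: dsumP => n /=; rewrite scale1r. Qed.
Fact dsum_scaleDr : right_distributive dsum_scale +%R.
Proof. by move=> a f g; apply: dsumP => n /=; rewrite scalerDr. Qed.
Fact dsum_scaleDl f : {morph dsum_scale^~ f : a b / a + b}.
Proof. by move=> a b; apply: dsumP => n /=; rewrite scalerDl. Qed.
HB.instance Definition _ := GRing.Zmodule_isLmodule.Build C dsum
  dsum_scaleA dsum_scale1 dsum_scaleDr dsum_scaleDl.

Lemma dval0 n : (0 : dsum) n = 0. Proof. by []. Qed.
Lemma dvalD f g n : (f + g) n = f n + g n. Proof. by []. Qed.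
Lemma dvalZ a f n : (a *: f) n = a *: f n. Proof. by []. Qed.

Definition dbound f : nat := sval (cid (dval_fin f)).

Lemma dboundP f n : (dbound f <= n)%N -> f n = 0.
Proof. exact: (svalP (cid (dval_fin f))). Qed.

(* The sum of '[f n, g n] over all n: the terms with n >= dbound f vanish. *)
Definition dsum_ip f g : C := \sum_(n < dbound f) '[f n, g n].

Lemma sum_ext (V : nmodType) (F : nat -> V) M N :
  (forall n, (M <= n)%N -> F n = 0) -> (M <= N)%N ->
  \sum_(n < M) F n = \sum_(n < N) F n.
Proof.
move=> FM MN; rewrite -!(big_mkord predT F) [RHS](@big_cat_nat _ _ _ M)//=.
by rewrite [X in _ + X]big_nat_cond [X in _ + X]big1 ?addr0// => n /andP[/andP[/FM]].
Qed.

Lemma sum_last (V : nmodType) (F : nat -> V) n :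
  (forall m, n != m -> F m = 0) -> \sum_(m < n.+1) F m = F n.
Proof.
move=> F0; rewrite big_ord_recr /= big1 ?add0r// => i _.
by rewrite F0// neq_ltn ltn_ord orbT.
Qed.

Lemma dsum_ipE f g N : (forall n, (N <= n)%N -> f n = 0) ->
  dsum_ip f g = \sum_(n < N) '[f n, g n].
Proof.
pose F n := '[f n, g n]; move=> fN.
rewrite /dsum_ip (sum_ext (F := F) _ (leq_maxl _ N)); last first.
  by move=> n /dboundP fn; rewrite /F fn ip0l.
rewrite -(sum_ext (F := F) _ (leq_maxr (dbound f) _))// => n /fN fn.
by rewrite /F fn ip0l.
Qed.

Fact dsum_ip_linearl g : scalar (dsum_ip^~ g).
Proof.
move=> a f h; pose N := maxn (dbound f) (dbound h).
have fN n : (N <= n)%N -> f n = 0.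
  by rewrite geq_max => /andP[/dboundP].
have hN n : (N <= n)%N -> h n = 0.
  by rewrite geq_max => /andP[_ /dboundP].
rewrite (dsum_ipE _ fN) (dsum_ipE _ hN) (@dsum_ipE _ _ N); last first.
  by move=> n Nn; rewrite dvalD dvalZ fN// hN// scaler0 addr0.
by rewrite mulr_sumr -big_split; apply: eq_bigr => n _; rewrite ipDl ipZl.
Qed.

Fact dsum_ip_conj f g : dsum_ip f g = (dsum_ip g f)^*.
Proof.
pose N := maxn (dbound f) (dbound g).
rewrite (@dsum_ipE _ _ N); last by move=> n; rewrite geq_max => /andP[/dboundP].
rewrite (@dsum_ipE _ _ N); last by move=> n; rewrite geq_max => /andP[_ /dboundP].
by rewrite rmorph_sum; apply: eq_bigr => n _; exact: ipC.
Qed.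

Fact dsum_ip_gt0 f : f != 0 -> 0 < dsum_ip f f.
Proof.
move=> f0; rewrite lt_neqAle sumr_ge0 ?andbT => [|n _]; last exact: ip_ge0.
apply: contra f0; rewrite eq_sym psumr_eq0 => [/allP fn|n _]; last exact: ip_ge0.
apply/eqP/dsumP => n; have [/dboundP//|nf] := leqP (dbound f) n.
by apply/eqP; have := fn (Ordinal nf); rewrite mem_index_enum /= ip_eq0; apply.
Qed.

HB.instance Definition _ :=
  isPreHilbert.Build C dsum dsum_ip_linearl dsum_ip_conj dsum_ip_gt0.

Lemma ip_dsumE f g N : (forall n, (N <= n)%N -> f n = 0) ->
  '[f, g] = \sum_(n < N) '[f n, g n].
Proof. exact: dsum_ipE. Qed.

Fact dinj_fin n (x : H n) :
  exists N, forall m, (N <= m)%N -> dfwith (fun m => 0 : H m) x m = 0.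
Proof.
by exists n.+1 => m nm; rewrite dfwith_out// neq_ltn nm.
Qed.
Definition dinj n (x : H n) : dsum := DSum (dinj_fin x).
Arguments dinj : simpl never.

Lemma dinj_in n (x : H n) : dinj x n = x. Proof. exact: dfwith_in. Qed.
Lemma dinj_out n (x : H n) m : n != m -> dinj x m = 0.
Proof. exact: dfwith_out. Qed.

Fact dinj_linear n : linear (@dinj n).
Proof.
move=> a x y; apply: dsumP => m; rewrite dvalD dvalZ.
have [<-|nm] := eqVneq n m; first by rewrite !dinj_in.
by rewrite !dinj_out// scaler0 addr0.
Qed.
HB.instance Definition _ n :=
  GRing.isLinear.Build C (H n) dsum *:%R (@dinj n) (@dinj_linear n).

Lemma dval_sum n I (r : seq I) (P : pred I) (F : I -> dsum) :
  (\sum_(i <- r | P i) F i) n = \sum_(i <- r | P i) F i n.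
Proof. exact: (big_morph (fun f : dsum => f n)). Qed.

Lemma dsum_decomp f N : (forall n, (N <= n)%N -> f n = 0) ->
  f = \sum_(n < N) dinj (f n).
Proof.
move=> fN; apply: dsumP => m; rewrite dval_sum.
have [Nm|mN] := leqP N m.
  by rewrite fN// big1// => i _; rewrite dinj_out// neq_ltn (leq_trans (ltn_ord i)).
rewrite (bigD1 (Ordinal mN))// big1 => [|i im]; last by rewrite dinj_out.
by rewrite -[RHS]/(dinj (f m) m + 0) addr0 dinj_in.
Qed.

Lemma ip_dinj n (x y : H n) : '[dinj x, dinj y] = '[x, y].
Proof.
rewrite (@ip_dsumE _ _ n.+1); last by move=> m nm; rewrite dinj_out// neq_ltn nm.
rewrite (sum_last (F := fun m => '[dinj x m, dinj y m])) ?dinj_in// => m nm.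
by rewrite dinj_out ?ip0l.
Qed.

End DirectSum.

Section DirectSumLift.
Variables (C : numClosedFieldType) (H : nat -> preHilbertType C) (W : lmodType C).
Variable g : forall n, {linear H n -> W}.

Definition dlift (f : dsum H) : W := \sum_(n < dbound f) g n (f n).

Lemma dliftE (f : dsum H) N : (forall n, (N <= n)%N -> f n = 0) ->
  dlift f = \sum_(n < N) g n (f n).
Proof.
pose F n := g n (f n); move=> fN.
rewrite /dlift (sum_ext (F := F) _ (leq_maxl _ N)); last first.
  by move=> n /dboundP fn; rewrite /F fn linear0.
rewrite -(sum_ext (F := F) _ (leq_maxr (dbound f) _))// => n /fN fn.
by rewrite /F fn linear0.
Qed.

Fact dlift_linear : linear dlift.
Proof.
move=> a f h; pose N := maxn (dbound f) (dbound h).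
have fN n : (N <= n)%N -> f n = 0.
  by rewrite geq_max => /andP[/dboundP].
have hN n : (N <= n)%N -> h n = 0.
  by rewrite geq_max => /andP[_ /dboundP].
rewrite (dliftE fN) (dliftE hN) (@dliftE _ N); last first.
  by move=> n Nn; rewrite dvalD dvalZ fN// hN// scaler0 addr0.
by rewrite scaler_sumr -big_split; apply: eq_bigr => n _; rewrite linearP.
Qed.
HB.instance Definition _ :=
  GRing.isLinear.Build C (dsum H) W *:%R dlift dlift_linear.

Lemma dlift_dinj n (x : H n) : dlift (dinj x) = g n x.
Proof.
rewrite (@dliftE _ n.+1); last by move=> m nm; rewrite dinj_out// neq_ltn nm.
rewrite (sum_last (F := fun m => g m (dinj x m))) ?dinj_in// => m nm.
by rewrite dinj_out ?linear0.
Qed.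

End DirectSumLift.

Section Multilinear.
Variables (C : numClosedFieldType) (K : preHilbertType C).

Definition tset n (x : n.-tuple K) (i : 'I_n) (y : K) : n.-tuple K :=
  [tuple if j == i then y else tnth x j | j < n].

Definition multilinear n (W : lmodType C) (f : n.-tuple K -> W) :=
  forall (x : n.-tuple K) (i : 'I_n), linear (fun y => f (tset x i y)).

Definition prodform n (x w : n.-tuple K) : C :=
  \prod_(i < n) '[tnth x i, tnth w i].

Lemma prodformC n (x w : n.-tuple K) : prodform x w = (prodform w x)^*.
Proof. by rewrite rmorph_prod; apply: eq_bigr => i _; exact: ipC. Qed.

Lemma prodform_tset n (x w : n.-tuple K) i y : prodform (tset x i y) w =
  '[y, tnth w i] * \prod_(j < n | j != i) '[tnth x j, tnth w j].
Proof.
rewrite /prodform (bigD1 i)//= tnth_mktuple eqxx; congr (_ * _).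
by apply: eq_bigr => j /negPf ji; rewrite tnth_mktuple ji.
Qed.

Lemma prodform_cons n y v (x w : n.-tuple K) :
  prodform (cons_tuple y x) (cons_tuple v w) = '[y, v] * prodform x w.
Proof.
rewrite /prodform big_ord_recl !tnth0; congr (_ * _).
by apply: eq_bigr => i _; rewrite !tnthS.
Qed.

Lemma tset_cons0 n (x : n.-tuple K) y z :
  tset (cons_tuple y x) ord0 z = cons_tuple z x.
Proof.
apply: eq_from_tnth => j; rewrite tnth_mktuple.
by case: (unliftP ord0 j) => [j'|] -> /=; rewrite ?tnthS ?tnth0.
Qed.

Lemma tset_consS n (x : n.-tuple K) i y z :
  tset (cons_tuple y x) (lift ord0 i) z = cons_tuple y (tset x i z).
Proof.
apply: eq_from_tnth => j; rewrite tnth_mktuple.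
case: (unliftP ord0 j) => [j'|] -> /=; rewrite ?tnthS ?tnth0//.
by rewrite tnth_mktuple (inj_eq lift_inj).
Qed.

Lemma multilinear_cons n (W : lmodType C) (f : n.+1.-tuple K -> W) :
  multilinear f -> forall y, multilinear (fun x : n.-tuple K => f (cons_tuple y x)).
Proof. by move=> fM y x i a u v; rewrite -!tset_consS; exact: fM. Qed.

Fixpoint tuples_of (e : seq K) n : seq (n.-tuple K) :=
  if n is n'.+1 then [seq cons_tuple v k | v <- e, k <- tuples_of e n']
  else [:: [tuple]].

Lemma multilinear_expansion (e : seq K) n (x : n.-tuple K) :
  (forall i, tnth x i = \sum_(v <- e) '[tnth x i, v] *: v) ->
  forall (W : lmodType C) (f : n.-tuple K -> W), multilinear f ->
  f x = \sum_(k <- tuples_of e n) prodform x k *: f k.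
Proof.
elim: n x => [|n IH] x xe W f fM.
  by rewrite big_seq1 /prodform big_ord0 scale1r; congr f; rewrite (tuple0 x); exact: val_inj.
case/tupleP: x xe => y x xe.
have ye : y = \sum_(v <- e) '[y, v] *: v by have := xe ord0; rewrite tnth0.
have {}xe i : tnth x i = \sum_(v <- e) '[tnth x i, v] *: v.
  by have := xe (lift ord0 i); rewrite tnthS.
have f0 : linear (fun z => f (cons_tuple z x)).
  by move=> a u v; have := fM (cons_tuple y x) ord0 a u v; rewrite !tset_cons0.
pose g := GRing.isLinear.Build C K W *:%R (fun z => f (cons_tuple z x)) f0.
pose F : {linear K -> W} := HB.pack (fun z => f (cons_tuple z x)) g.
rewrite -[LHS]/(F y) {1}ye linear_sum big_allpairs_dep.
apply: eq_bigr => v _; transitivity ('[y, v] *: F v); first by rewrite -linearZ.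
rewrite /= (IH x xe W _ (multilinear_cons fM v)).
rewrite scaler_sumr; apply: eq_bigr => k _.
by rewrite prodform_cons scalerA.
Qed.

Lemma multilinear_expansions n (s : seq (n.-tuple K)) :
  exists ks : seq (n.-tuple K), forall x, x \in s ->
  forall (W : lmodType C) (f : n.-tuple K -> W), multilinear f ->
  f x = \sum_(k <- ks) prodform x k *: f k.
Proof.
have [e _ es] := orthonormal_expansion (flatten [seq val x | x : n.-tuple K <- s]).
exists (tuples_of e n) => x xs; apply: multilinear_expansion => i.
rewrite [LHS]es; first by rewrite (big_nth 0) big_mkord.
by apply/flattenP; exists (val x); [exact: map_f|exact: mem_tnth].
Qed.

End Multilinear.

(* The n-th algebraic tensor power of K, realized as the span of the functions
   w |-> \prod_i '[x i, w i], one for each n-tuple x. These functions represent the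
   elementary tensors; tensor_universal below is the universal property. *)
Section TensorPower.
Variables (C : numClosedFieldType) (n : nat) (K : preHilbertType C).

Record tpow := TPow {
  tval :> n.-tuple K -> C;
  tval_span : exists s : seq (C * n.-tuple K),
    forall w, tval w = \sum_(p <- s) p.1 * prodform p.2 w
}.
Implicit Types t u v : tpow.

HB.instance Definition _ := gen_eqMixin tpow.
HB.instance Definition _ := gen_choiceMixin tpow.

Lemma tpowP t u : (forall w, t w = u w) -> t = u.
Proof.
case: t u => [t tP] [u uP] /= /funext tu.
by case: _ / tu uP => uP; congr TPow; exact: Prop_irrelevance.
Qed.

Fact tpow0_span : exists s : seq (C * n.-tuple K),
  forall w, 0 = \sum_(p <- s) p.1 * prodform p.2 w.
Proof. by exists [::] => w; rewrite big_nil. Qed.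
Definition tpow0 := TPow tpow0_span.

Fact tpow_add_span t u : exists s : seq (C * n.-tuple K),
  forall w, t w + u w = \sum_(p <- s) p.1 * prodform p.2 w.
Proof.
have [[s sE] [r rE]] := (tval_span t, tval_span u).
by exists (s ++ r) => w; rewrite big_cat sE rE.
Qed.
Definition tpow_add t u := TPow (tpow_add_span t u).

Fact tpow_scale_span a t : exists s : seq (C * n.-tuple K),
  forall w, a * t w = \sum_(p <- s) p.1 * prodform p.2 w.
Proof.
have [s sE] := tval_span t.
exists [seq (a * p.1, p.2) | p <- s] => w; rewrite big_map sE mulr_sumr.
by apply: eq_bigr => p _; rewrite mulrA.
Qed.
Definition tpow_scale a t := TPow (tpow_scale_span a t).

Definition tpow_opp := tpow_scale (-1).

Fact tpow_addA : associative tpow_add.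
Proof. by move=> t u v; apply: tpowP => w /=; rewrite addrA. Qed.
Fact tpow_addC : commutative tpow_add.
Proof. by move=> t u; apply: tpowP => w /=; rewrite addrC. Qed.
Fact tpow_add0 : left_id tpow0 tpow_add.
Proof. by move=> t; apply: tpowP => w /=; rewrite add0r. Qed.
Fact tpow_addN : left_inverse tpow0 tpow_opp tpow_add.
Proof. by move=> t; apply: tpowP => w /=; rewrite mulN1r addNr. Qed.
HB.instance Definition _ :=
  GRing.isZmodule.Build tpow tpow_addA tpow_addC tpow_add0 tpow_addN.

Fact tpow_scaleA a b t : tpow_scale a (tpow_scale b t) = tpow_scale (a * b) t.
Proof. by apply: tpowP => w /=; rewrite mulrA. Qed.
Fact tpow_scale1 : left_id 1 tpow_scale.
Proof. by move=> t; apply: tpowP => w /=; rewrite mul1r. Qed.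
Fact tpow_scaleDr : right_distributive tpow_scale +%R.
Proof. by move=> a t u; apply: tpowP => w /=; rewrite mulrDr. Qed.
Fact tpow_scaleDl t : {morph tpow_scale^~ t : a b / a + b}.
Proof. by move=> a b; apply: tpowP => w /=; rewrite mulrDl. Qed.
HB.instance Definition _ := GRing.Zmodule_isLmodule.Build C tpow
  tpow_scaleA tpow_scale1 tpow_scaleDr tpow_scaleDl.

Lemma tval0 w : (0 : tpow) w = 0. Proof. by []. Qed.
Lemma tvalD t u w : (t + u) w = t w + u w. Proof. by []. Qed.
Lemma tvalZ a t w : (a *: t) w = a * t w. Proof. by []. Qed.
Lemma tval_sum I (r : seq I) (P : pred I) (F : I -> tpow) w :
  (\sum_(i <- r | P i) F i) w = \sum_(i <- r | P i) F i w.
Proof. exact: (big_morph (fun t : tpow => t w)). Qed.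

Fact tens_span (x : n.-tuple K) : exists s : seq (C * n.-tuple K),
  forall w, prodform x w = \sum_(p <- s) p.1 * prodform p.2 w.
Proof. by exists [:: (1, x)] => w; rewrite big_seq1 mul1r. Qed.
Definition tens (x : n.-tuple K) : tpow := TPow (tens_span x).

Lemma tensE x w : tens x w = prodform x w. Proof. by []. Qed.

Lemma tens_multilinear : multilinear tens.
Proof.
move=> x i a y z; apply: tpowP => w.
by rewrite tvalD tvalZ !tensE !prodform_tset ipDl ipZl mulrDl mulrA.
Qed.

Definition trep t : seq (C * n.-tuple K) := sval (cid (tval_span t)).

Lemma trepE t w : t w = \sum_(p <- trep t) p.1 * prodform p.2 w.
Proof. exact: (svalP (cid (tval_span t))). Qed.

Lemma tens_decomp t : t = \sum_(p <- trep t) p.1 *: tens p.2.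
Proof. by apply: tpowP => w; rewrite tval_sum trepE. Qed.

Definition tpow_ip t u : C := \sum_(p <- trep u) (p.1)^* * t p.2.

Lemma tpow_ipE t u (s : seq (C * n.-tuple K)) :
  (forall w, u w = \sum_(p <- s) p.1 * prodform p.2 w) ->
  tpow_ip t u = \sum_(p <- s) (p.1)^* * t p.2.
Proof.
suff E (r : seq (C * n.-tuple K)) :
    (forall w, u w = \sum_(p <- r) p.1 * prodform p.2 w) ->
    \sum_(p <- r) (p.1)^* * t p.2 = \sum_(q <- trep t) q.1 * (u q.2)^*.
  by move=> sE; rewrite [RHS]E// /tpow_ip E// => w; exact: trepE.
move=> rE; under eq_bigr do rewrite trepE mulr_sumr.
rewrite exchange_big; apply: eq_bigr => q _ /=.
rewrite rE rmorph_sum mulr_sumr; apply: eq_bigr => p _ /=.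
by rewrite rmorphM /= -prodformC mulrCA.
Qed.

Lemma tpow_ip_tens t x : tpow_ip t (tens x) = t x.
Proof.
rewrite (@tpow_ipE _ _ [:: (1, x)]); last by move=> w; rewrite big_seq1 mul1r.
by rewrite big_seq1 rmorph1 mul1r.
Qed.

Fact tpow_ip_linearl u : scalar (tpow_ip^~ u).
Proof.
move=> a t v; rewrite /tpow_ip mulr_sumr -big_split; apply: eq_bigr => p _.
by rewrite tvalD tvalZ mulrDr mulrCA.
Qed.

Fact tpow_ip_conj t u : tpow_ip t u = (tpow_ip u t)^*.
Proof.
rewrite /tpow_ip rmorph_sum; under eq_bigr do rewrite trepE mulr_sumr.
rewrite exchange_big; apply: eq_bigr => q _ /=.
rewrite rmorphM /= conjCK trepE rmorph_sum mulr_sumr; apply: eq_bigr => p _ /=.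
by rewrite rmorphM /= -prodformC mulrCA.
Qed.

Lemma tens_expansions (s : seq tpow) : exists ks : seq (n.-tuple K),
  forall t, t \in s -> t = \sum_(k <- ks) t k *: tens k.
Proof.
have [ks ksE] := multilinear_expansions (flatten [seq unzip2 (trep t) | t <- s]).
exists ks => t ts; rewrite [LHS]tens_decomp big_seq.
under eq_bigr => p pt.
  rewrite (ksE p.2 _ _ _ tens_multilinear); last first.
    by apply/flattenP; exists (unzip2 (trep t)); exact: map_f.
  rewrite scaler_sumr; under eq_bigr do rewrite scalerA.
  over.
rewrite -big_seq exchange_big; apply: eq_bigr => k _.
by rewrite -scaler_suml trepE.
Qed.

Fact tpow_ip_gt0 t : t != 0 -> 0 < tpow_ip t t.
Proof.
have [ks /(_ t (mem_head _ _)) tE] := tens_expansions [:: t].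
have -> : tpow_ip t t = \sum_(k <- ks) `|t k| ^+ 2.
  rewrite (@tpow_ipE _ _ [seq (t k, k) | k <- ks]).
    by rewrite big_map; apply: eq_bigr => k _; rewrite normCK mulrC.
  by move=> w; rewrite {1}tE tval_sum big_map.
move=> t0; rewrite lt_neqAle sumr_ge0 ?andbT => [|k _]; last exact: exprn_ge0.
apply: contra t0; rewrite eq_sym psumr_eq0 => [/allP tk|k _]; last exact: exprn_ge0.
apply/eqP; rewrite tE big_seq big1// => k /tk /=.
by rewrite sqrf_eq0 normr_eq0 => /eqP->; rewrite scale0r.
Qed.

HB.instance Definition _ :=
  isPreHilbert.Build C tpow tpow_ip_linearl tpow_ip_conj tpow_ip_gt0.

Lemma ip_tens x y : '[tens x, tens y] = \prod_(i < n) '[tnth x i, tnth y i].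
Proof. exact: tpow_ip_tens. Qed.

Lemma ip_tensr t x : '[t, tens x] = t x.
Proof. exact: tpow_ip_tens. Qed.

Section Lift.
Variables (W : lmodType C) (f : n.-tuple K -> W).

Definition tlift t : W := \sum_(p <- trep t) p.1 *: f p.2.

Hypothesis fM : multilinear f.

Lemma tliftE t (s : seq (C * n.-tuple K)) :
  (forall w, t w = \sum_(p <- s) p.1 * prodform p.2 w) ->
  tlift t = \sum_(p <- s) p.1 *: f p.2.
Proof.
move=> sE; have [ks ksE] := multilinear_expansions (unzip2 (trep t ++ s)).
suff E (r : seq (C * n.-tuple K)) : {subset r <= trep t ++ s} ->
    (forall w, t w = \sum_(p <- r) p.1 * prodform p.2 w) ->
    \sum_(p <- r) p.1 *: f p.2 = \sum_(k <- ks) t k *: f k.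
  rewrite /tlift !E// => [p ps|p pt|w]; last exact: trepE.
    by rewrite mem_cat ps orbT.
  by rewrite mem_cat pt.
move=> rs rE; rewrite big_seq.
under eq_bigr => p pr.
  rewrite (ksE p.2 _ _ _ fM); last by apply: map_f; exact: rs.
  rewrite scaler_sumr; under eq_bigr do rewrite scalerA.
  over.
rewrite -big_seq exchange_big; apply: eq_bigr => k _.
by rewrite -scaler_suml rE.
Qed.

Lemma tlift_tens x : tlift (tens x) = f x.
Proof.
rewrite (@tliftE _ [:: (1, x)]) ?big_seq1 ?scale1r// => w.
by rewrite big_seq1 mul1r.
Qed.

Lemma tlift_linear : linear tlift.
Proof.
move=> a t u.
rewrite (@tliftE _ ([seq (a * p.1, p.2) | p <- trep t] ++ trep u)).
  rewrite big_cat big_map /= scaler_sumr; congr (_ + _).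
  by apply: eq_bigr => p _; rewrite scalerA.
move=> w; rewrite big_cat big_map tvalD tvalZ /= !trepE mulr_sumr.
by congr (_ + _); apply: eq_bigr => p _; rewrite mulrA.
Qed.

End Lift.

Theorem tensor_universal (W : lmodType C) (f : n.-tuple K -> W) :
  multilinear f -> exists2 g : {linear tpow -> W}, (forall x, g (tens x) = f x) &
    forall h : {linear tpow -> W}, (forall x, h (tens x) = f x) -> h =1 g.
Proof.
move=> fM.
pose g : {linear tpow -> W} :=
  HB.pack (tlift f) (GRing.isLinear.Build C tpow W *:%R (tlift f) (tlift_linear fM)).
have gE x : g (tens x) = f x by exact: tlift_tens.
clearbody g; exists g => // h hE t; rewrite (tens_decomp t) !linear_sum.
by apply: eq_bigr => p _; rewrite !linearZ /= hE gE.
Qed.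

End TensorPower.

Section ComplexLimits.
Variable R : realType.
Local Notation C := R[i].

Lemma normc_ge_Im (x : C) : `|complex.Im x|%:C%C <= `|x|.
Proof.
by case: x => a b; simpc; rewrite -sqrtr_sqr ler_wsqrtr// lerDr sqr_ge0.
Qed.

(* Taken coordinatewise, since the library puts no topology on R[i]. *)
Definition clim (z : nat -> C) : C :=
  (lim (complex.Re (z n) @[n --> \oo]) +i* lim (complex.Im (z n) @[n --> \oo]))%C.

Definition ccvg (z : nat -> C) (l : C) :=
  forall e : C, 0 < e -> exists N, forall n, (N <= n)%N -> `|z n - l| < e.

Lemma cvgRP (x : nat -> R) (l : R) : (forall e : R, 0 < e ->
    exists N, forall n, (N <= n)%N -> `|x n - l| < e) -> x n @[n --> \oo] --> l.
Proof.
move=> xl; apply/cvgrPdist_lt => e e0; have [N NP] := xl e e0.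
by exists N => // n /= Nn; rewrite distrC; exact: NP.
Qed.

Lemma ccvg_clim z l : ccvg z l -> clim z = l.
Proof.
move=> zl; rewrite /clim [RHS](_ : l = (complex.Re l +i* complex.Im l)%C); last by case: l {zl}.
congr (_ +i* _)%C; apply: cvg_lim => //; apply: cvgRP => e e0;
    (have [|N NP] := zl e%:C%C; first by rewrite ltcR); exists N => n Nn;
    rewrite -ltcR; apply: le_lt_trans (NP n Nn); rewrite -raddfB.
  exact: normc_ge_Re.
exact: normc_ge_Im.
Qed.

Lemma real_cauchy_cvg (x : nat -> R) :
  (forall e : R, 0 < e -> exists N, forall m n, (N <= m)%N -> (N <= n)%N ->
    `|x m - x n| < e) -> exists l, forall e : R, 0 < e ->
    exists N, forall n, (N <= n)%N -> `|x n - l| < e.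
Proof.
move=> xc; have : cvg (x n @[n --> \oo]).
  apply: cauchy_cvg; apply: cauchy_exP => e e0; have [N NP] := xc e e0.
  by exists (x N); exists N => // n /= Nn; rewrite /ball /=; exact: NP.
move=> /cvg_ex[l /cvgrPdist_lt xl]; exists l => e e0.
by have [N _ NP] := xl e e0; exists N => n Nn; rewrite distrC; exact: NP.
Qed.

Lemma complex_cauchy_cvg (z : nat -> C) :
  (forall e : C, 0 < e -> exists N, forall m n, (N <= m)%N -> (N <= n)%N ->
    `|z m - z n| < e) -> exists l, ccvg z l.
Proof.
move=> zc.
have [|a aP] := @real_cauchy_cvg (fun n => complex.Re (z n)).
  move=> e e0; have [|N NP] := zc e%:C%C; first by rewrite ltcR.
  exists N => m n Nm Nn; rewrite -ltcR; apply: le_lt_trans (NP m n Nm Nn).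
  by rewrite -raddfB; exact: normc_ge_Re.
have [|b bP] := @real_cauchy_cvg (fun n => complex.Im (z n)).
  move=> e e0; have [|N NP] := zc e%:C%C; first by rewrite ltcR.
  exists N => m n Nm Nn; rewrite -ltcR; apply: le_lt_trans (NP m n Nm Nn).
  by rewrite -raddfB; exact: normc_ge_Im.
exists (a +i* b)%C => -[e e'].
rewrite ltcE /= => /andP[/eqP -> {e'} e0].
have e20 : 0 < e / 2 by rewrite divr_gt0.
have [[M MP] [N NP]] := (aP _ e20, bP _ e20).
exists (maxn M N) => n; rewrite geq_max => /andP[Mn Nn].
have := MP n Mn; have := NP n Nn; case: (z n) => c d /= dP cP.
rewrite -[X in _ < X]/(e%:C%C) normc_def ltcR /=.
apply: (@le_lt_trans _ _ (`|c - a| + `|d - b|)); last by rewrite [e]splitr ltrD.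
rewrite -[leRHS]ger0_norm ?addr_ge0// -sqrtr_sqr ler_wsqrtr//.
rewrite [leRHS]sqrrD !real_normK ?num_real// addrAC lerDl.
by rewrite mulrn_wge0// mulr_ge0.
Qed.

Lemma ccvg_unique z l l' : ccvg z l -> ccvg z l' -> l = l'.
Proof. by move=> /ccvg_clim <- /ccvg_clim. Qed.

Lemma ccvg_near z w l : ccvg z l -> ccvg (fun n => w n - z n) 0 -> ccvg w l.
Proof.
move=> zl wz e e0; have e20 : 0 < e / 2 by rewrite divr_gt0.
have [[M MP] [N NP]] := (zl _ e20, wz _ e20).
exists (maxn M N) => n; rewrite geq_max => /andP[/MP zn /NP]; rewrite subr0 => wn.
by rewrite [e]splitr -(subrK (z n) (w n)) -addrA (le_lt_trans (ler_normD _ _))// ltrD.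
Qed.

Lemma ccvgD z w l k : ccvg z l -> ccvg w k -> ccvg (fun n => z n + w n) (l + k).
Proof.
move=> zl wk e e0; have e20 : 0 < e / 2 by rewrite divr_gt0.
have [[M MP] [N NP]] := (zl _ e20, wk _ e20).
exists (maxn M N) => n; rewrite geq_max => /andP[/MP zn /NP wn].
by rewrite [e]splitr opprD addrACA (le_lt_trans (ler_normD _ _))// ltrD.
Qed.

Lemma ccvgZ (a : C) z l : ccvg z l -> ccvg (fun n => a * z n) (a * l).
Proof.
have [->|a0] := eqVneq a 0 => zl e e0.
  by exists 0 => n _; rewrite !mul0r subrr normr0.
have [|N NP] := zl (e / `|a|); first by rewrite divr_gt0 ?normr_gt0.
by exists N => n /NP; rewrite -mulrBr normrM ltr_pdivlMr ?normr_gt0// mulrC.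
Qed.

Lemma ccvg_conj z l : ccvg z l -> ccvg (fun n => Num.conj (z n)) (Num.conj l).
Proof.
move=> zl e e0; have [N NP] := zl e e0.
by exists N => n /NP; rewrite -rmorphB norm_conjC.
Qed.

Lemma ccvg_cst (l : C) : ccvg (fun=> l) l.
Proof. by move=> e e0; exists 0 => n _; rewrite subrr normr0. Qed.

Lemma ccvg_ge0 z l : (forall n, 0 <= z n) -> ccvg z l -> 0 <= l.
Proof.
move=> z0 zl; pose w n : C := `|z n|.
have lE : l = `|l|.
  apply: (@ccvg_unique w).
    by have -> : w = z by apply/funext => n; exact: ger0_norm.
  move=> e e0; have [N NP] := zl e e0; exists N => n /NP; apply: le_lt_trans.
  exact: ler_dist_dist.
by rewrite lE.
Qed.

End ComplexLimits.

Section Sequences.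
Variables (C : numClosedFieldType) (V : preHilbertType C).

Definition cauchy_seq (u : nat -> V) := forall e : C, 0 < e ->
  exists N, forall m n, (N <= m)%N -> (N <= n)%N -> nrm (u m - u n) < e.

Definition null_seq (u : nat -> V) := forall e : C, 0 < e ->
  exists N, forall n, (N <= n)%N -> nrm (u n) < e.

End Sequences.

Section Completion.
Variables (R : realType) (V : preHilbertType R[i]).
Local Notation C := R[i].
Local Open Scope quotient_scope.

Record cseq := CSeq { cval :> nat -> V; cvalP : cauchy_seq cval }.
Implicit Types u v w : cseq.

HB.instance Definition _ := gen_eqMixin cseq.
HB.instance Definition _ := gen_choiceMixin cseq.

Lemma null_seqD (x y : nat -> V) :
  null_seq x -> null_seq y -> null_seq (fun n => x n + y n).
Proof.
move=> x0 y0 e e0; have e20 : 0 < e / 2 by rewrite divr_gt0.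
have [[M MP] [N NP]] := (x0 _ e20, y0 _ e20).
exists (maxn M N) => n; rewrite geq_max => /andP[/MP zn /NP wn].
by rewrite [e]splitr (le_lt_trans (ler_nrmD _ _))// ltrD.
Qed.

Lemma null_seqZ a (x : nat -> V) : null_seq x -> null_seq (fun n => a *: x n).
Proof.
move=> x0 e e0; have [->|a0] := eqVneq a 0.
  by exists 0 => n _; rewrite scale0r nrm0.
have [|N NP] := x0 (e / `|a|); first by rewrite divr_gt0 ?normr_gt0.
by exists N => n /NP; rewrite nrmZ ltr_pdivlMr ?normr_gt0// mulrC.
Qed.

Definition cequiv u v : bool := `[< null_seq (fun n => u n - v n) >].

Fact cequiv_refl : reflexive cequiv.
Proof. by move=> u; apply/asboolP => e e0; exists 0 => n _; rewrite subrr nrm0. Qed.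
Fact cequiv_sym : symmetric cequiv.
Proof.
move=> u v; apply/asboolP/asboolP => uv e /uv[N NP];
  by exists N => n; rewrite nrm_distC; exact: NP.
Qed.
Fact cequiv_trans : transitive cequiv.
Proof.
move=> v u w /asboolP uv /asboolP vw; apply/asboolP.
by have := null_seqD uv vw; congr null_seq; apply/funext => n; rewrite addrA subrK.
Qed.

Canonical cequiv_rel := EquivRel cequiv cequiv_refl cequiv_sym cequiv_trans.

Definition completion := {eq_quot cequiv}.
HB.instance Definition _ := Choice.on completion.
HB.instance Definition _ := EqQuotient.on completion.
Implicit Types X Y Z : completion.

Lemma completion_eqP u v :
  null_seq (fun n => u n - v n) <-> \pi_completion u = \pi_completion v.
Proof. by split=> [uv|/eqmodP/asboolP//]; apply/eqmodP/asboolP. Qed.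

Lemma repr_null u : null_seq (fun n => repr (\pi_completion u) n - u n).
Proof. by apply/completion_eqP; rewrite reprK. Qed.

Fact cst_cauchy (x : V) : cauchy_seq (fun=> x).
Proof. by move=> e e0; exists 0 => m n _ _; rewrite subrr nrm0. Qed.
Definition completion_embed (x : V) : completion := \pi_completion (CSeq (cst_cauchy x)).

Fact cadd_cauchy u v : cauchy_seq (fun n => u n + v n).
Proof.
move=> e e0; have e20 : 0 < e / 2 by rewrite divr_gt0.
have [[M MP] [N NP]] := (cvalP u e20, cvalP v e20).
exists (maxn M N) => m n; rewrite !geq_max => /andP[Mm Nm] /andP[Mn Nn].
rewrite [e]splitr opprD addrACA (le_lt_trans (ler_nrmD _ _))// ltrD//.
  exact: MP.
exact: NP.
Qed.

Fact cscale_cauchy a u : cauchy_seq (fun n => a *: u n).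
Proof.
move=> e e0; have [->|a0] := eqVneq a 0.
  by exists 0 => m n _ _; rewrite !scale0r subrr nrm0.
have [|N NP] := @cvalP u (e / `|a|); first by rewrite divr_gt0 ?normr_gt0.
exists N => m n Nm Nn; rewrite -scalerBr nrmZ -ltr_pdivlMl ?normr_gt0// mulrC.
exact: NP.
Qed.

Definition cadd X Y : completion := \pi_completion (CSeq (cadd_cauchy (repr X) (repr Y))).
Definition cscale a X : completion := \pi_completion (CSeq (cscale_cauchy a (repr X))).

Lemma caddE u v : cadd (\pi_completion u) (\pi_completion v) = \pi_completion (CSeq (cadd_cauchy u v)).
Proof.
apply/completion_eqP; have := null_seqD (repr_null u) (repr_null v).
by congr null_seq; apply/funext => n /=; rewrite opprD addrACA.
Qed.

Lemma cscaleE a u : cscale a (\pi_completion u) = \pi_completion (CSeq (cscale_cauchy a u)).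
Proof.
apply/completion_eqP; have := null_seqZ a (repr_null u).
by congr null_seq; apply/funext => n /=; rewrite scalerBr.
Qed.

Lemma cseqP u v : (forall n, u n = v n) -> u = v.
Proof.
case: u v => [u uP] [v vP] /= /funext uv.
by case: _ / uv vP => vP; congr CSeq; exact: Prop_irrelevance.
Qed.

Lemma pi_ext u v : (forall n, u n = v n) -> \pi_completion u = \pi_completion v.
Proof. by move=> /cseqP->. Qed.

Ltac rep X := rewrite -[X]reprK; move: (repr X) => {}X.

Fact caddA : associative cadd.
Proof.
move=> X Y Z; rep X; rep Y; rep Z.
rewrite (caddE Y Z) caddE (caddE X Y) caddE.
by apply: pi_ext => n /=; rewrite addrA.
Qed.
Fact caddC : commutative cadd.
Proof.
move=> X Y; rep X; rep Y; rewrite !caddE.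
by apply: pi_ext => n /=; rewrite addrC.
Qed.
Fact cadd0 : left_id (completion_embed 0) cadd.
Proof.
move=> X; rep X; rewrite caddE.
by apply: pi_ext => n /=; rewrite add0r.
Qed.
Fact caddN : left_inverse (completion_embed 0) (cscale (-1)) cadd.
Proof.
move=> X; rep X; rewrite cscaleE caddE.
by apply: pi_ext => n /=; rewrite scaleN1r addNr.
Qed.
HB.instance Definition _ :=
  GRing.isZmodule.Build completion caddA caddC cadd0 caddN.

Fact cscaleA a b X : cscale a (cscale b X) = cscale (a * b) X.
Proof.
rep X; rewrite (cscaleE b) !cscaleE.
by apply: pi_ext => n /=; rewrite scalerA.
Qed.
Fact cscale1 : left_id 1 cscale.
Proof.
move=> X; rep X; rewrite cscaleE.
by apply: pi_ext => n /=; rewrite scale1r.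
Qed.
Fact cscaleDr : right_distributive cscale +%R.
Proof.
move=> a X Y; rep X; rep Y; rewrite -[LHS]/(cscale a (cadd (\pi_completion X) (\pi_completion Y))).
rewrite (caddE X Y) !cscaleE -[RHS]/(cadd _ _) caddE.
by apply: pi_ext => n /=; rewrite scalerDr.
Qed.
Fact cscaleDl X : {morph cscale^~ X : a b / a + b}.
Proof.
move=> a b; rep X; rewrite -[RHS]/(cadd _ _) !cscaleE caddE.
by apply: pi_ext => n /=; rewrite scalerDl.
Qed.
HB.instance Definition _ := GRing.Zmodule_isLmodule.Build C completion
  cscaleA cscale1 cscaleDr cscaleDl.

Lemma piD u v : \pi_completion u + \pi_completion v = \pi_completion (CSeq (cadd_cauchy u v)).
Proof. exact: caddE. Qed.
Lemma piZ a u : a *: \pi_completion u = \pi_completion (CSeq (cscale_cauchy a u)).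
Proof. exact: cscaleE. Qed.

Lemma cauchy_bounded u : exists2 B : C, 0 < B & forall n, nrm (u n) <= B.
Proof.
have [N NP] := @cvalP u 1 ltr01.
exists (1 + \sum_(i < N.+1) nrm (u i)).
  by rewrite ltr_pwDl// sumr_ge0// => i _; exact: nrm_ge0.
move=> n; have [nN|Nn] := leqP n N.
  rewrite (bigD1 (Ordinal (nN : (n < N.+1)%N)))//= addrCA lerDl.
  by rewrite addr_ge0// sumr_ge0// => i _; exact: nrm_ge0.
rewrite -[u n](subrK (u N)) (le_trans (ler_nrmD _ _))// lerD//.
  by rewrite ltW// NP// ltnW.
rewrite (bigD1 ord_max)//= lerDl sumr_ge0// => i _; exact: nrm_ge0.
Qed.

Lemma ip_bound (x y x' y' : V) :
  `|'[x, y] - '[x', y']| <= nrm (x - x') * nrm y + nrm x' * nrm (y - y').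
Proof.
have -> : '[x, y] - '[x', y'] = '[x - x', y] + '[x', y - y'].
  by rewrite ipBl ipBr addrA subrK.
by rewrite (le_trans (ler_normD _ _))// lerD// cauchy_schwarz.
Qed.

Lemma ip_cauchy u v : exists l, ccvg (fun n => '[u n, v n]) l.
Proof.
apply: complex_cauchy_cvg => e e0.
have [[A A0 uA] [B B0 vB]] := (cauchy_bounded u, cauchy_bounded v).
have eA : 0 < e / 2 / A by rewrite !divr_gt0.
have eB : 0 < e / 2 / B by rewrite !divr_gt0.
have [[M MP] [N NP]] := (cvalP u eB, cvalP v eA).
exists (maxn M N) => m n; rewrite !geq_max => /andP[Mm Nm] /andP[Mn Nn].
apply: le_lt_trans (ip_bound _ _ _ _) _; rewrite [e]splitr.
have h1 : nrm (u m - u n) * nrm (v m) <= nrm (u m - u n) * B.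
  by rewrite ler_wpM2l ?nrm_ge0.
have h2 : nrm (u n) * nrm (v m - v n) <= A * nrm (v m - v n).
  by rewrite ler_wpM2r ?nrm_ge0.
apply: le_lt_trans (lerD h1 h2) _; rewrite ltrD//.
  by rewrite -ltr_pdivlMr//; exact: MP.
by rewrite -ltr_pdivlMl// mulrC; exact: NP.
Qed.

Lemma ip_near u v u' v' : null_seq (fun n => u n - u' n) ->
  null_seq (fun n => v n - v' n) -> ccvg (fun n => '[u n, v n] - '[u' n, v' n]) 0.
Proof.
move=> uu vv e e0.
have [[A A0 uA] [B B0 vB]] := (cauchy_bounded u', cauchy_bounded v).
have eA : 0 < e / 2 / A by rewrite !divr_gt0.
have eB : 0 < e / 2 / B by rewrite !divr_gt0.
have [[M MP] [N NP]] := (uu _ eB, vv _ eA).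
exists (maxn M N) => n; rewrite !geq_max subr0 => /andP[Mn Nn].
apply: le_lt_trans (ip_bound _ _ _ _) _; rewrite [e]splitr.
have h1 : nrm (u n - u' n) * nrm (v n) <= nrm (u n - u' n) * B.
  by rewrite ler_wpM2l ?nrm_ge0.
have h2 : nrm (u' n) * nrm (v n - v' n) <= A * nrm (v n - v' n).
  by rewrite ler_wpM2r ?nrm_ge0.
apply: le_lt_trans (lerD h1 h2) _; rewrite ltrD//.
  by rewrite -ltr_pdivlMr//; exact: MP.
by rewrite -ltr_pdivlMl// mulrC; exact: NP.
Qed.

Definition completion_ip X Y : C := clim (fun n => '[repr X n, repr Y n]).

Lemma completion_ip_cvg u v :
  ccvg (fun n => '[u n, v n]) (completion_ip (\pi_completion u) (\pi_completion v)).
Proof.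
have [l uvl] := ip_cauchy u v.
suff -> : completion_ip (\pi_completion u) (\pi_completion v) = l by [].
by apply: ccvg_clim; apply: ccvg_near uvl _; apply: ip_near; exact: repr_null.
Qed.

Fact completion_ip_linearl Z : scalar (completion_ip^~ Z).
Proof.
move=> a X Y; rep X; rep Y; rep Z; rewrite piZ piD.
apply: ccvg_unique (completion_ip_cvg _ _) _.
have := ccvgD (ccvgZ a (completion_ip_cvg X Z)) (completion_ip_cvg Y Z).
by congr ccvg; apply/funext => n /=; rewrite ipDl ipZl.
Qed.

Fact completion_ip_conj X Y : completion_ip X Y = (completion_ip Y X)^*.
Proof.
rep X; rep Y; apply: ccvg_unique (completion_ip_cvg _ _) _.
have := ccvg_conj (completion_ip_cvg Y X).
by congr ccvg; apply/funext => n /=; rewrite -ipC.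
Qed.

Fact completion_ip_gt0 X : X != 0 -> 0 < completion_ip X X.
Proof.
rep X => X0; have Xc := completion_ip_cvg X X.
rewrite lt_neqAle (ccvg_ge0 _ Xc) ?andbT => [|n]; last exact: ip_ge0.
apply: contra X0 => /eqP Xe; apply/eqP/completion_eqP => e e0 /=.
have [|N NP] := Xc (e ^+ 2); first exact: exprn_gt0.
exists N => n /NP; rewrite -Xe !subr0 -nrm_sq ger0_norm ?exprn_ge0 ?nrm_ge0//.
by rewrite ltr_pXn2r// ?qualifE/= ?nrm_ge0 ?ltW.
Qed.

HB.instance Definition _ := isPreHilbert.Build C completion
  completion_ip_linearl completion_ip_conj completion_ip_gt0.

Fact completion_embed_linear : linear completion_embed.
Proof.
by move=> a x y; rewrite piZ piD; exact: pi_ext.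
Qed.
HB.instance Definition _ := GRing.isLinear.Build C V completion *:%R
  completion_embed completion_embed_linear.

Lemma completion_embed_isometry x y :
  '[completion_embed x, completion_embed y] = '[x, y].
Proof.
apply: (@ccvg_unique _ (fun=> '[x, y])); last exact: ccvg_cst.
exact: (completion_ip_cvg (CSeq (cst_cauchy x)) (CSeq (cst_cauchy y))).
Qed.

Lemma nrm_embed x : nrm (completion_embed x) = nrm x.
Proof. by rewrite /nrm completion_embed_isometry. Qed.

Lemma nrm_pi_le u (e : C) : 0 <= e ->
  (exists N, forall n, (N <= n)%N -> nrm (u n) <= e) -> nrm (\pi_completion u) <= e.
Proof.
move=> e0 [N NP]; rewrite -(@ler_pXn2r _ 2) ?qualifE/= ?nrm_ge0// nrm_sq.
rewrite -subr_ge0; apply: (@ccvg_ge0 _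
  (fun n => e ^+ 2 - '[u (N + n)%N, u (N + n)%N])).
  move=> n; rewrite subr_ge0 -nrm_sq ler_pXn2r ?qualifE/= ?nrm_ge0//.
  by rewrite NP// leq_addr.
move=> d /(completion_ip_cvg u u)[M MP]; exists M => n Mn.
rewrite -normrN opprB opprB addrC addrA subrK.
by apply: MP; rewrite (leq_trans Mn)// leq_addl.
Qed.

Lemma embed_cvg u (e : C) : 0 < e ->
  exists N, forall n, (N <= n)%N ->
    nrm (\pi_completion u - completion_embed (u n)) < e.
Proof.
move=> e0; have e20 : 0 < e / 2 by rewrite divr_gt0.
have [N NP] := cvalP u e20; exists N => n Nn.
apply: (@le_lt_trans _ _ (e / 2)); last first.
  by rewrite ltr_pdivrMr// ltr_pMr// ltr1n.
rewrite -scaleN1r piZ piD; apply: nrm_pi_le; first exact: ltW.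
by exists N => m Nm /=; rewrite scaleN1r ltW// NP.
Qed.

Lemma completion_embed_dense X (e : C) : 0 < e ->
  exists x, nrm (X - completion_embed x) < e.
Proof. by move=> e0; rep X; have [N NP] := embed_cvg X e0; exists (X N); exact: NP. Qed.

End Completion.

Section CompletionComplete.
Variables (R : realType) (V : preHilbertType R[i]).
Local Notation C := R[i].

Lemma invn_small (e : C) : 0 < e ->
  exists N, forall n, (N <= n)%N -> n.+1%:R^-1 < e.
Proof.
case: e => e e'; rewrite ltcE /= => /andP[/eqP -> {e'} e0].
move: e0 => /posnumP[{}e]; have [N _ NP] := near_infty_natSinv_lt e.
exists N => n /NP /= ne.
have -> : n.+1%:R^-1 = (n.+1%:R^-1)%:C%C :> C by rewrite fmorphV rmorph_nat.
by rewrite -[X in _ < X]/(e%:num%:C%C) ltcR.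
Qed.

Theorem completion_complete (U : nat -> completion V) :
  cauchy_seq U -> exists X, null_seq (fun n => U n - X).
Proof.
move=> Uc.
have small n : exists x, nrm (U n - completion_embed x) < n.+1%:R^-1.
  by apply: completion_embed_dense; rewrite invr_gt0 ltr0n.
pose u n := sval (cid (small n)).
have uP n : nrm (U n - completion_embed (u n)) < n.+1%:R^-1.
  exact: (svalP (cid (small n))).
have uc : cauchy_seq u.
  move=> e e0; have e30 : 0 < e / 3 by rewrite divr_gt0.
  have [[M MP] [N NP]] := (Uc _ e30, invn_small e30).
  exists (maxn M N) => m n; rewrite !geq_max => /andP[Mm Nm] /andP[Mn Nn].
  rewrite -nrm_embed linearB /=.
  apply: le_lt_trans (ler_dist_nrmD (U m) _ _) _.
  have h : nrm (U m - completion_embed (u n)) < e / 3 + e / 3.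
    apply: le_lt_trans (ler_dist_nrmD (U n) _ _) _.
    by rewrite ltrD ?MP// (lt_trans (uP n))// NP.
  rewrite nrm_distC (_ : e = e / 3 + (e / 3 + e / 3)); last first.
    by rewrite -!mulrDl -[X in _ = X / _]/(e *+ 3) -[e *+ 3]mulr_natr mulfK// pnatr_eq0.
  by rewrite ltrD// (lt_trans (uP m))// NP.
exists (\pi_(completion V) (CSeq uc))%qT => e e0.
have e20 : 0 < e / 2 by rewrite divr_gt0.
have [[M MP] [N NP]] := (embed_cvg (CSeq uc) e20, invn_small e20).
exists (maxn M N) => n; rewrite geq_max => /andP[Mn Nn].
apply: le_lt_trans (ler_dist_nrmD (completion_embed (u n)) _ _) _.
rewrite [e]splitr ltrD//; first by rewrite (lt_trans (uP n))// NP.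
by rewrite nrm_distC; exact: MP.
Qed.

End CompletionComplete.

Section FockSpace.
Variables (C : numClosedFieldType) (K : preHilbertType C).

Definition Fock : preHilbertType C := dsum (fun n => tpow n K : preHilbertType C).

Definition ftens n (x : n.-tuple K) : Fock :=
  @dinj C (fun n => tpow n K : preHilbertType C) n (tens x).

Definition fock_vacuum : Fock := ftens [tuple].

End FockSpace.

Definition lin_span (C : numClosedFieldType) (V : lmodType C) (S : set V) : set V :=
  [set v | exists2 s : seq (C * V), forall p, p \in s -> S p.2 &
    v = \sum_(p <- s) p.1 *: p.2].

Definition degree1 (C : numClosedFieldType) (H : nat -> preHilbertType C) :
    set (dsum H -> dsum H) :=
  [set a | linear a /\
    forall n (x : H n), exists y : H n.+1, a (dinj x) = dinj y].
Arguments degree1 {C} H.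

Record interacting_fock_space (C : numClosedFieldType) := InteractingFockSpace {
  level : nat -> preHilbertType C;
  vacuum : level 0;
  creators : set (dsum level -> dsum level);
  vacuum_unit : '[vacuum, vacuum] = 1;
  vacuum_span : forall x : level 0, exists c, x = c *: vacuum;
  creators_linear : forall a, creators a -> linear a;
  creators0 : creators 0;
  creatorsP : forall c a b, creators a -> creators b -> creators (c *: a + b);
  creators_span : forall n,
    lin_span [set a (dinj x) | a in creators & x in [set: level n]] =
    range (@dinj C level n.+1)
}.
Arguments vacuum {C} _.
Arguments creators {C} _.

Definition ifs_space C (I : interacting_fock_space C) : preHilbertType C :=
  dsum (level I).

Definition full C (I : interacting_fock_space C) := creators I = degree1 (level I).

Definition non_nilpotent C (I : interacting_fock_space C) :=
  forall n, exists x : level I n, x != 0.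

Record basing C (I : interacting_fock_space C) (K : preHilbertType C) := Basing {
  creator :> {linear K -> (ifs_space I -> ifs_space I)};
  creator_range : range creator = creators I
}.

Section Lambda.
Variables (C : numClosedFieldType) (I : interacting_fock_space C).
Variables (K : preHilbertType C) (a : basing I K).

Fact creator_linear x : linear (a x).
Proof. by apply: creators_linear; rewrite -(creator_range a); exists x. Qed.

(* The tuple [tuple x_n; ...; x_1] stands for x_n (x) ... (x) x_1: its head is
   the factor whose creator acts last. *)
Definition create n (x : n.-tuple K) : ifs_space I :=
  foldr (fun y v => a y v) (dinj (vacuum I)) x.

Lemma create_cons n y (x : n.-tuple K) : create (cons_tuple y x) = a y (create x).
Proof. by []. Qed.

Fact create_multilinear n : multilinear (@create n).
Proof.
elim: n => [|n IH] x i; first by case: i.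
case/tupleP: x => y x c u v.
case: (unliftP ord0 i) => [j|] ->.
  by rewrite !tset_consS !create_cons IH creator_linear.
by rewrite !tset_cons0 !create_cons linearP.
Qed.

Definition Lambda : {linear Fock K -> ifs_space I} :=
  dlift (fun n => HB.pack (tlift (@create n)) (GRing.isLinear.Build C (tpow n K)
    (ifs_space I) *:%R (tlift (@create n)) (tlift_linear (@create_multilinear n)))
    : {linear tpow n K -> ifs_space I}).

Lemma Lambda_ftens n (x : n.-tuple K) : Lambda (ftens x) = create x.
Proof. by rewrite /Lambda /= dlift_dinj /= tlift_tens//; exact: create_multilinear. Qed.

Lemma Lambda_vacuum : Lambda (fock_vacuum K) = dinj (vacuum I).
Proof. exact: Lambda_ftens. Qed.

Lemma Lambda_unique (L : {linear Fock K -> ifs_space I}) :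
  (forall n (x : n.-tuple K), L (ftens x) = create x) -> L =1 Lambda.
Proof.
move=> LE X; rewrite [X in L X](dsum_decomp (@dboundP _ _ X)).
rewrite [X in Lambda X](dsum_decomp (@dboundP _ _ X)) !linear_sum.
apply: eq_bigr => n _; rewrite (tens_decomp (X n)) !linear_sum.
apply: eq_bigr => p _; rewrite !linearZ; congr (_ *: _).
by rewrite [LHS]LE [RHS]Lambda_ftens.
Qed.

End Lambda.

Definition regular_basing (R : realType) (I : interacting_fock_space R[i])
    (K : preHilbertType R[i]) (a : basing I K) :=
  exists La : {linear ifs_space I -> completion (Fock K)},
    forall (X : Fock K) (Y : ifs_space I),
      '[Lambda a X, Y] = '[completion_embed X, La Y].

Definition regular (R : realType) (I : interacting_fock_space R[i]) :=
  exists (K : preHilbertType R[i]) (a : basing I K), regular_basing a.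

(* For the operators of degree 1 the axiom creators_span is automatic when no
   level vanishes, so every such family H carries a full interacting Fock space. *)
Section FullIFS.
Variables (C : numClosedFieldType) (H : nat -> preHilbertType C) (W : H 0).
Hypothesis W_unit : '[W, W] = 1.
Hypothesis W_span : forall x : H 0, exists c, x = c *: W.
Hypothesis H_neq0 : forall n, exists x : H n, x != 0.

Fact degree1_linear a : degree1 H a -> linear a. Proof. by case. Qed.

Fact degree1_0 : degree1 H 0.
Proof.
split=> [c x y|n x]; first by rewrite /= scaler0 addr0.
by exists 0; rewrite linear0.
Qed.

Fact degree1P c a b : degree1 H a -> degree1 H b -> degree1 H (c *: a + b).
Proof.
move=> [aL aH] [bL bH]; split=> [d x y|n x].
  rewrite -![(c *: a + b) _]/(c *: a _ + b _) aL bL !scalerDr !scalerA addrACA.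
  by rewrite mulrC.
have [[y ay] [z bz]] := (aH n x, bH n x).
by exists (c *: y + z); rewrite [RHS]linearP /= -ay -bz.
Qed.

Definition rank_one n (x : H n) (y : H n.+1) (f : dsum H) : dsum H :=
  dinj ('[f n, x] *: y).

Lemma rank_one_degree1 n (x : H n) (y : H n.+1) : degree1 H (rank_one x y).
Proof.
split=> [c f g|m z].
  by rewrite /rank_one dvalD dvalZ ipDl ipZl scalerDl -scalerA linearP.
rewrite /rank_one; have [e|nm] := eqVneq m n.
  by case: n / e x y => x y; exists ('[dinj z m, x] *: y).
by exists 0; rewrite dinj_out// ip0l scale0r !linear0.
Qed.

Fact degree1_span n :
  lin_span [set a (dinj x) | a in degree1 H & x in [set: H n]] =
  range (@dinj C H n.+1).
Proof.
apply/seteqP; split=> [v [s sP ->]|_ [y _ <-]].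
  elim: s sP => [|p s IH] sP.
    by exists 0 => //; rewrite big_nil linear0.
  have [|z _ zE] := IH; first by move=> q qs; apply: sP; rewrite inE qs orbT.
  have [b [_ bH] [x _ bx]] := sP p (mem_head _ _).
  have [y bE] := bH n x; exists (p.1 *: y + z) => //.
  by rewrite big_cons linearP /= zE -bx bE.
have [x x0] := H_neq0 n.
exists [:: (1, dinj y)]; last by rewrite big_seq1 scale1r.
move=> p; rewrite inE => /eqP -> /=.
exists (rank_one ('[x, x]^-1 *: x) y); first exact: rank_one_degree1.
exists x => //; rewrite /rank_one dinj_in ipZr fmorphV /= -ipC.
by rewrite mulVf ?scale1r// ip_eq0.
Qed.

Definition full_ifs : interacting_fock_space C :=
  InteractingFockSpace W_unit W_span degree1_linear degree1_0 degree1P degree1_span.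

Lemma full_ifs_full : full full_ifs. Proof. by []. Qed.
Lemma full_ifs_non_nilpotent : non_nilpotent full_ifs. Proof. exact: H_neq0. Qed.

End FullIFS.

(* Main.v *)
Require Import Defs.
From HB Require Import structures.
From mathcomp Require Import all_boot all_order all_algebra complex reals.
From mathcomp Require boolp.

Set Implicit Arguments.
Unset Strict Implicit.
Unset Printing Implicit Defensive.

Import Order.TTheory GRing.Theory Num.Theory.

Local Open Scope ring_scope.

(** A regular basing makes the action of creators on the vacuum grow at most
geometrically: if [La] is the adjoint of [Lambda], Cauchy-Schwarz in the
completed Fock space bounds the inner product of [a(x)^n Omega] with [Y] by
[nrm x ^+ n * nrm (La Y)], where the second factor depends on [Y] but not on
[x] ([regular_create_bound]). The space of all operators of degree 1 has no
such growth restriction. Given any nonzero vectors [y n] in the levels, with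
[y 0] the vacuum, there is an operator of degree 1 sending [y n] to [y n.+1]
for every [n] ([degree1_chain]); fullness makes it a creator [a x], so that
[a(x)^n Omega = y n]. Because [La] is linear while the inner product of [y n]
with itself is quadratic, scaling [y n] makes [n ^ n * nrm (La (y n))] smaller
than ['[y n, y n]] ([quadratic_dominates]). The geometric bound with [Y = y n]
then forces [n < nrm x] for all [n >= 1], against the Archimedean property. *)

Lemma nrm_ftens_nseq (C : numClosedFieldType) (K : preHilbertType C) n (x : K) :
  nrm (ftens (nseq_tuple n x)) = nrm x ^+ n.
Proof.
rewrite /nrm /ftens ip_dinj ip_tens.
under eq_bigr do rewrite tnth_nseq.
by rewrite prodr_const card_ord rootCX ?ip_ge0.
Qed.

Lemma regular_create_bound (R : realType) (I : interacting_fock_space R[i])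
    (K : preHilbertType R[i]) (a : basing I K)
    (La : {linear ifs_space I -> completion (Fock K)}) :
  (forall X Y, '[Lambda a X, Y] = '[completion_embed X, La Y]) ->
  forall n x (Y : ifs_space I),
    `|'[create a (nseq_tuple n x), Y]| <= nrm x ^+ n * nrm (La Y).
Proof.
move=> La_adj n x Y; rewrite -Lambda_ftens La_adj -nrm_ftens_nseq -nrm_embed.
exact: cauchy_schwarz.
Qed.

(** The operator is the linear extension, over the algebraic direct sum, of the
rank one maps that send [y n] to [y n.+1] and the orthogonal complement of
[y n] to [0]; the vectors [y n] may grow arbitrarily fast. *)
Lemma degree1_chain (C : numClosedFieldType) (H : nat -> preHilbertType C)
    (y : forall n, H n) : (forall n, y n != 0) ->
  exists2 b, degree1 H b & forall n, b (dinj (y n)) = dinj (y n.+1).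
Proof.
move=> y_neq0.
pose g n (z : H n) : dsum H := dinj (('[z, y n] / '[y n, y n]) *: y n.+1).
have g_linear n : linear (@g n).
  by move=> c u v; rewrite /g ipDl ipZl mulrDl scalerDl -mulrA -scalerA linearP.
pose G n : {linear H n -> dsum H} := HB.pack (@g n)
  (GRing.isLinear.Build C (H n) (dsum H) *:%R (@g n) (g_linear n)).
exists (dlift G) => [|n]; last first.
  by rewrite dlift_dinj /= /g divff ?scale1r// ip_eq0.
split=> [|n z]; first exact: dlift_linear.
by rewrite dlift_dinj /= /g; eexists.
Qed.

Lemma full_create_chain (C : numClosedFieldType) (I : interacting_fock_space C)
    (K : preHilbertType C) (a : basing I K) (y : forall n, level I n) :
  full I -> y 0%N = vacuum I -> (forall n, y n != 0) ->
  exists x, forall n, create a (nseq_tuple n x) = dinj (y n).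
Proof.
move=> fullI y0 /degree1_chain[b].
rewrite -fullI -(creator_range a) => -[x _ xE] bE.
exists x; elim=> [|n IH]; first by rewrite y0.
by rewrite -bE -IH /create /= xE.
Qed.

Lemma quadratic_dominates (C : numClosedFieldType) (V W : preHilbertType C)
    (L : {linear V -> W}) (c : C) (z : V) : 0 <= c -> z != 0 ->
  exists t : C, c * nrm (L (t *: z)) < '[t *: z, t *: z].
Proof.
move=> c0 z0; have zz : 0 < '[z, z] by rewrite ip_gt0.
pose t := (c * nrm (L z) + 1) / '[z, z].
have t0 : 0 < t by rewrite divr_gt0 ?ltr_wpDl ?mulr_ge0 ?nrm_ge0.
exists t; rewrite linearZ /= nrmZ ipZl ipZr geC0_conj ?(ltW t0)// gtr0_norm//.
by rewrite mulrCA ltr_pM2l// /t divfK ?gt_eqF// ltrDl.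
Qed.

Theorem theorem3p5 (R : realType) (I : interacting_fock_space R[i]) :
  full I -> non_nilpotent I -> ~ regular I.
Proof.
move=> fullI nonnil [K [a [La La_adj]]].
have dominated n : exists y : level I n,
    n%:R ^+ n * nrm (La (dinj y)) < '[y, y].
  have [z z0] := nonnil n.
  have [||t tP] := @quadratic_dominates _ _ _ La (n%:R ^+ n) (dinj z).
  - by rewrite exprn_ge0.
  - by rewrite -ip_eq0 ip_dinj ip_eq0.
  by exists (t *: z); rewrite -ip_dinj linearZ.
pose y n : level I n :=
  if n is k.+1 then sval (boolp.cid (dominated k.+1)) else vacuum I.
have yP n : n.+1%:R ^+ n.+1 * nrm (La (dinj (y n.+1))) < '[y n.+1, y n.+1].
  exact: (svalP (boolp.cid (dominated n.+1))).
have y_neq0 n : y n != 0.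
  rewrite -ip_eq0; case: n => [|n]; first by rewrite vacuum_unit oner_eq0.
  by rewrite gt_eqF// (le_lt_trans _ (yP n))// mulr_ge0 ?exprn_ge0 ?nrm_ge0.
have [x xE] := full_create_chain a fullI (erefl : y 0%N = vacuum I) y_neq0.
have x_large n : n.+1%:R < nrm x.
  have := regular_create_bound La_adj n.+1 x (dinj (y n.+1)).
  rewrite xE ip_dinj ger0_norm ?ip_ge0// => /(lt_le_trans (yP n)) lt_n.
  rewrite -(@ltr_pXn2r _ n.+1) ?qualifE/= ?nrm_ge0//.
  have [La0|La0] := eqVneq (nrm (La (dinj (y n.+1)))) 0.
    by move: lt_n; rewrite La0 !mulr0 ltxx.
  by rewrite -(ltr_pM2r (x := nrm (La (dinj (y n.+1))))) // lt_def La0 nrm_ge0.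
have x0 : 0 < nrm x by exact: lt_trans (x_large 0%N).
have [|N /(_ N (leqnn N))] := @invn_small R (nrm x)^-1; first by rewrite invr_gt0.
by rewrite ltf_pV2 ?qualifE/= ?ltr0n// => /lt_trans/(_ (x_large N)); rewrite ltxx.
Qed.
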